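(* Let $\Pi$ be a mini-gringo program and let $I$ be a set of precomputed atoms. Then $I$ is a stable model of $\Pi$ if and only if $I$ is a well-supported model of $\Pi$.
   Context: Mini-gringo syntax. Fix countably infinite sets of numerals, symbolic constants and program variables, and a bijection $n\mapsto\overline{n}$ from the integers to the numerals. Program terms are: numerals, symbolic constants, program variables, the symbols $\mathit{inf}$ and $\mathit{sup}$; $|t|$ for a term $t$; and $(t_1\circ t_2)$ for terms $t_1,t_2$ and $\circ\in\{+,-,\times,/,\backslash,..\}$. A term (or expression) without variables is ground; a ground term without operation symbols is precomputed. The precomputed terms are totally ordered so that $\mathit{inf}$ is least, $\mathit{sup}$ is greatest and $\overline{m}<\overline{n}$ iff $m<n$. An atom is $p(\mathbf{t})$ with $p$ a symbolic constant and $\mathbf{t}$ a tuple of terms; a literal is an atom preceded by zero, one or two occurrences of $\mathit{not}$; a comparison is $t_1\prec t_2$ with $\prec\in\{=,\neq,<,>,\le,\ge\}$. A rule is $\mathit{Head}\leftarrow\mathit{Body}$, where $\mathit{Body}$ is a possibly empty conjunction of literals and comparisons and $\mathit{Head}$ is an atom $p(\mathbf t)$ (basic rule), $\{p(\mathbf t)\}$ (choice rule) or empty (constraint). A program is a finite set of rules; each predicate symbol occurs with a single arity. For a rule $R$: $\mathrm{Body}(R)$ is its body, $B^+(R)$ is the set of atoms occurring un-negated in its body, and $\mathrm{HeadLit}(R)=p(\mathbf t)$ if the head is $p(\mathbf t)$ or $\{p(\mathbf t)\}$. An instance of a rule is obtained by replacing all its variables by precomputed terms. Values. For a ground term $t$,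 the set $\mathrm{vals}(t)$: $\{t\}$ if $t$ is a numeral, symbolic constant, $\mathit{inf}$ or $\mathit{sup}$; for $|t_1|$ the numerals $\overline{|n|}$ with $\overline n\in\mathrm{vals}(t_1)$; for $t_1\circ t_2$, $\circ\in\{+,-,\times\}$, the numerals $\overline{n_1\circ n_2}$ with $\overline{n_i}\in\mathrm{vals}(t_i)$; for $t_1/t_2$ the numerals $\overline{\mathrm{rd}(n_1/n_2)}$ and for $t_1\backslash t_2$ the numerals $\overline{n_1-n_2\cdot\mathrm{rd}(n_1/n_2)}$, with $\overline{n_i}\in\mathrm{vals}(t_i)$ and $n_2\ne0$, where $\mathrm{rd}(x)=\lfloor x\rfloor$ if $x\ge0$ and $\lceil x\rceil$ if $x<0$; for $t_1..t_2$ the numerals $\overline m$ with $n_1\le m\le n_2$ for some $\overline{n_i}\in\mathrm{vals}(t_i)$. For a tuple, $\mathrm{vals}(t_1,\dots,t_n)$ is the set of tuples $(r_1,\dots,r_n)$ with $r_i\in\mathrm{vals}(t_i)$. Translation $\tau$ (on ground expressions). $\tau(p(\mathbf t))=\bigvee_{\mathbf r\in\mathrm{vals}(\mathbf t)}p(\mathbf r)$, $\tau(\mathit{not}\,p(\mathbf t))=\bigvee_{\mathbf r}\neg p(\mathbf r)$, $\tau(\mathit{not}\,\mathit{not}\,p(\mathbf t))=\bigvee_{\mathbf r}\neg\neg p(\mathbf r)$; $\tau(t_1\prec t_2)$ is $\top$ if $r_1\prec r_2$ holds for some $r_i\in\mathrm{vals}(t_i)$ and $\bot$ otherwise; $\tau$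 of a conjunction is the conjunction of the $\tau$'s. For a ground basic rule $\tau(R)=\tau(\mathit{Body})\to\bigwedge_{\mathbf r\in\mathrm{vals}(\mathbf t)}p(\mathbf r)$; for a ground choice rule $\tau(R)=\tau(\mathit{Body})\to\bigwedge_{\mathbf r}(p(\mathbf r)\vee\neg p(\mathbf r))$; for a ground constraint $\tau(R)=\neg\tau(\mathit{Body})$. $\tau(\Pi)$ is the set of $\tau(R)$ for all instances $R$ of rules of $\Pi$. Stable models. Here $\neg F$ abbreviates $F\to\bot$. For a propositional formula $F$ and a set $I$ of precomputed atoms, the reduct $F^I$ is $\bot$ if $I\not\models F$; $p$ if $F$ is an atom $p$ with $I\models p$; and $G^I\otimes H^I$ if $F=G\otimes H$ with $\otimes\in\{\wedge,\vee,\to\}$ and $I\models F$. $\Gamma^I=\{F^I:F\in\Gamma\}$. $I$ is a stable model of a theory $\Gamma$ iff $I$ is the $\subseteq$-minimal model of $\Gamma^I$; $I$ is a stable model of a program $\Pi$ iff it is a stable model of $\tau(\Pi)$. Well-supported models. A strict well-founded partial order on $I$ is an irreflexive, transitive relation $\prec$ on $I$ with no infinite sequence $a_0,a_1,\dots$ such that $a_{i+1}\prec a_i$ for all $i$. $I$ is a well-supported interpretation of $\Pi$ iff there is a strict well-founded partial order $\prec$ on $I$ such that for every $p(\mathbf r)\in I$ there is an instance $R$ of a rule of $\Pi$ with: (1) $\mathrm{HeadLit}(R)=p(\mathbf t)$ and $\mathbf r\in\mathrm{vals}(\mathbf t)$; (2) $I\models\tau(\mathrm{Body}(R))$; (3)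 for every $q(\mathbf t')\in B^+(R)$ there is $\mathbf r'\in\mathrm{vals}(\mathbf t')$ with $q(\mathbf r')\in I$ and $q(\mathbf r')\prec p(\mathbf r)$. $I$ is a well-supported model of $\Pi$ iff it is a well-supported interpretation of $\Pi$ and $I\models\tau(\Pi)$. *)

(* Defs.v *)
From HB Require Import structures.
From mathcomp Require Import all_boot all_order all_algebra.
From mathcomp Require Import boolp classical_sets cardinality.
From Stdlib Require List.

Set Implicit Arguments.
Unset Strict Implicit.
Unset Printing Implicit Defensive.

Import Order.TTheory GRing.Theory Num.Theory.
Local Open Scope classical_set_scope.
Local Open Scope ring_scope.

(* Numerals are the image of the constructor Numeral, which is the bijection
   from the integers. *)
Inductive precomputed (S : Type) : Type :=
| Inf
| Numeral of int
| Symbol of S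
| Sup.
Arguments Inf {S}.
Arguments Numeral {S} _.
Arguments Sup {S}.

Definition precomputed_code (S : Type) (r : precomputed S) : bool + (int + S) :=
  match r with
  | Inf => inl false
  | Numeral n => inr (inl n)
  | Symbol s => inr (inr s)
  | Sup => inl true
  end.

Definition precomputed_decode (S : Type) (c : bool + (int + S)) :
    precomputed S :=
  match c with
  | inl b => if b then Sup else Inf
  | inr (inl n) => Numeral n
  | inr (inr s) => Symbol s
  end.

Lemma precomputed_codeK (S : Type) :
  cancel (@precomputed_code S) (@precomputed_decode S).
Proof. by case. Qed.

HB.instance Definition _ (S : countType) :=
  Countable.copy (precomputed S) (can_type (@precomputed_codeK S)).

Definition strict (T : eqType) (le : rel T) : rel T :=
  fun x y => (x != y) && le x y.

Record language : Type := Language {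
  symb : countType;
  var : countType;
  symb_infinite : infinite_set [set: symb];
  var_infinite : infinite_set [set: var];
  ple : rel (precomputed symb);
  ple_refl : reflexive ple;
  ple_anti : antisymmetric ple;
  ple_trans : transitive ple;
  ple_total : total ple;
  ple_inf : forall r, ple Inf r;
  ple_sup : forall r, ple r Sup;
  plt_numeral : forall m n : int,
    strict ple (Numeral m) (Numeral n) = (m < n)
}.

Definition pterm (L : language) : countType := precomputed (symb L).

Definition plt (L : language) : rel (pterm L) := strict (@ple L).

Inductive binop : Set := OAdd | OSub | OMul | ODiv | OMod | OInterval.

(* Expressions are indexed by their type V of variables: program expressions
   take V := var L, ground expressions take V := void. *)
Inductive term (L : language) (V : Type) : Type :=
| TPre of pterm L
| TVar of V
| TAbs of term L V
| TBin of binop & term L V & term L V.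
Arguments TPre {L V} _.

Record atom (L : language) (V : Type) : Type := Atom {
  pred_symb : symb L;
  args : seq (term L V)
}.

Inductive sign : Set := Pos | Not | NotNot.

Inductive cmp : Set := CEq | CNeq | CLt | CGt | CLe | CGe.

Inductive body_elt (L : language) (V : Type) : Type :=
| Literal of sign & atom L V
| Comparison of cmp & term L V & term L V.

Inductive head (L : language) (V : Type) : Type :=
| HBasic of atom L V
| HChoice of atom L V
| HConstraint.
Arguments HConstraint {L V}.

Record rule (L : language) (V : Type) : Type := Rule {
  rule_head : head L V;
  rule_body : seq (body_elt L V)
}.

Definition head_lit (L : language) (V : Type) (R : rule L V) :
    option (atom L V) :=
  match rule_head R with
  | HBasic a => Some a
  | HChoice a => Some a
  | HConstraint => None
  end.

Definition body_pos (L : language) (V : Type) (R : rule L V) :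
    set (atom L V) :=
  [set a | List.In (Literal Pos a) (rule_body R)].

Definition occurs_in (L : language) (V : Type) (a : atom L V) (R : rule L V) :
    Prop :=
  head_lit R = Some a \/ exists s, List.In (Literal s a) (rule_body R).

Record program (L : language) : Type := Program {
  rules : set (rule L (var L));
  rules_finite : finite_set rules;
  rules_single_arity : forall R R' a a', rules R -> rules R' ->
    occurs_in a R -> occurs_in a' R' -> pred_symb a = pred_symb a' ->
    size (args a) = size (args a')
}.

Section Instances.
Context (L : language) (V : Type) (sigma : V -> pterm L).

Fixpoint inst_term (t : term L V) : term L void :=
  match t with
  | TPre r => TPre r
  | TVar x => TPre (sigma x)
  | TAbs t1 => TAbs (inst_term t1)
  | TBin o t1 t2 => TBin o (inst_term t1) (inst_term t2)
  end.

Definition inst_atom (a : atom L V) : atom L void :=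
  Atom (pred_symb a) (map inst_term (args a)).

Definition inst_body_elt (b : body_elt L V) : body_elt L void :=
  match b with
  | Literal s a => Literal s (inst_atom a)
  | Comparison c t1 t2 => Comparison c (inst_term t1) (inst_term t2)
  end.

Definition inst_head (h : head L V) : head L void :=
  match h with
  | HBasic a => HBasic (inst_atom a)
  | HChoice a => HChoice (inst_atom a)
  | HConstraint => HConstraint
  end.

Definition inst_rule (R : rule L V) : rule L void :=
  Rule (inst_head (rule_head R)) (map inst_body_elt (rule_body R)).

End Instances.

Definition instances (L : language) (Pi : program L) : set (rule L void) :=
  [set R' | exists R sigma, rules Pi R /\ R' = inst_rule sigma R].

Definition rd (x : rat) : int := if 0 <= x then Num.floor x else Num.ceil x.

Definition int_range (m n : int) : seq int :=
  if m <= n then [seq m + k%:Z | k <- iota 0 `|n - m|%N.+1] else [::].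

Definition binop_vals (o : binop) (n1 n2 : int) : seq int :=
  match o with
  | OAdd => [:: n1 + n2]
  | OSub => [:: n1 - n2]
  | OMul => [:: n1 * n2]
  | ODiv => if n2 == 0 then [::] else [:: rd (n1%:Q / n2%:Q)]
  | OMod => if n2 == 0 then [::] else [:: n1 - n2 * rd (n1%:Q / n2%:Q)]
  | OInterval => int_range n1 n2
  end.

Definition numeral_value (S : Type) (r : precomputed S) : option int :=
  if r is Numeral n then Some n else None.

(* vals t is a finite set, given as a duplicate-free sequence. *)
Fixpoint vals (L : language) (t : term L void) : seq (pterm L) :=
  match t with
  | TPre r => [:: r]
  | TVar x => match x with end
  | TAbs t1 =>
      undup [seq Numeral `|n| | n <- pmap (@numeral_value _) (vals t1)]
  | TBin o t1 t2 =>
      undup [seq Numeral n |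
        n <- flatten [seq binop_vals o n1 n2 |
               n1 <- pmap (@numeral_value _) (vals t1),
               n2 <- pmap (@numeral_value _) (vals t2)]]
  end.

Fixpoint vals_tuple (L : language) (ts : seq (term L void)) :
    seq (seq (pterm L)) :=
  if ts is t :: ts' then [seq r :: rs | r <- vals t, rs <- vals_tuple ts']
  else [:: [::]].

Lemma mem_int_range (m n k : int) : (k \in int_range m n) = (m <= k <= n).
Proof.
rewrite /int_range; case: ifPn => [lemn|]; last first.
  rewrite -ltNge => ltnm; rewrite in_nil; apply/esym/negP => /andP[mk kn].
  by have := le_lt_trans (le_trans mk kn) ltnm; rewrite ltxx.
have Edist : (`|n - m|%N)%:Z = n - m by rewrite gez0_abs // subr_ge0.
apply/mapP/idP => [[i]|/andP[mk kn]].
  rewrite mem_iota add0n ltnS => /andP[_ lti] ->.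
  by rewrite lerDl /= -lerBrDl -Edist lez_nat.
have Ek : (`|k - m|%N)%:Z = k - m by rewrite gez0_abs // subr_ge0.
exists `|k - m|%N; last by rewrite Ek addrC subrK.
by rewrite mem_iota /= add0n ltnS -lez_nat Ek Edist lerD2r.
Qed.

Lemma mem_numeral_values (S : countType) (s : seq (precomputed S)) (n : int) :
  (n \in pmap (@numeral_value S) s) = (Numeral n \in s).
Proof.
elim: s => //= -[|m|c|] s IHs /=; rewrite !inE ?IHs //.
Qed.

Lemma mem_vals_abs (L : language) (t : term L void) (r : pterm L) :
  r \in vals (TAbs t) <->
  exists2 n : int, Numeral n \in vals t & r = Numeral `|n|.
Proof.
rewrite /= mem_undup; split=> [/mapP[n]|[n tn ->]].
  by rewrite mem_numeral_values => tn ->; exists n.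
by apply/mapP; exists n; rewrite ?mem_numeral_values.
Qed.

Lemma mem_vals_bin (L : language) (o : binop) (t1 t2 : term L void)
    (r : pterm L) :
  r \in vals (TBin o t1 t2) <->
  exists n1 n2 n : int, [/\ Numeral n1 \in vals t1, Numeral n2 \in vals t2,
    n \in binop_vals o n1 n2 & r = Numeral n].
Proof.
rewrite /= mem_undup; split=> [/mapP[n /flattenP[s /allpairsP[[n1 n2] /=]]]|].
  by rewrite !mem_numeral_values => -[t1n t2n ->] on ->; exists n1, n2, n.
move=> [n1] [n2] [n] [t1n t2n on ->]; apply/map_f/flattenP.
exists (binop_vals o n1 n2) => //; apply/allpairsP; exists (n1, n2).
by rewrite !mem_numeral_values.
Qed.

Lemma vals_uniq (L : language) (t : term L void) : uniq (vals t).
Proof. by case: t => [r|[]|t|o t1 t2] //=; rewrite undup_uniq. Qed.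

Lemma mem_vals_tuple (L : language) (ts : seq (term L void))
    (rs : seq (pterm L)) :
  (rs \in vals_tuple ts) = all2 (fun r t => r \in vals t) rs ts.
Proof.
elim: ts rs => [|t ts IHts] [|r rs] //=.
  by apply/negP => /allpairsP[[? ?] []].
rewrite -IHts; apply/allpairsP/andP => [[[r' rs'] /= [tr tsrs [-> ->]]]|[tr tsrs]].
  by [].
by exists (r, rs).
Qed.

Lemma vals_tuple_uniq (L : language) (ts : seq (term L void)) :
  uniq (vals_tuple ts).
Proof.
elim: ts => //= t ts IHts; apply: allpairs_uniq => //; first exact: vals_uniq.
by move=> [r rs] [r' rs'] _ _ /= [-> ->].
Qed.

Definition patom (L : language) : Type := (symb L * seq (pterm L))%type.

Inductive formula (A : Type) : Type :=
| FBot
| FAtom of A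
| FAnd of formula A & formula A
| FOr of formula A & formula A
| FImp of formula A & formula A.
Arguments FBot {A}.

Definition FNot (A : Type) (F : formula A) : formula A := FImp F FBot.
Definition FTop {A : Type} : formula A := FImp FBot FBot.

Fixpoint bigFAnd (A : Type) (s : seq (formula A)) : formula A :=
  match s with
  | [::] => FTop
  | [:: F] => F
  | F :: s' => FAnd F (bigFAnd s')
  end.

Fixpoint bigFOr (A : Type) (s : seq (formula A)) : formula A :=
  match s with
  | [::] => FBot
  | [:: F] => F
  | F :: s' => FOr F (bigFOr s')
  end.

Fixpoint sat (A : Type) (I : set A) (F : formula A) : Prop :=
  match F with
  | FBot => False
  | FAtom a => I a
  | FAnd G H => sat I G /\ sat I H
  | FOr G H => sat I G \/ sat I H
  | FImp G H => sat I G -> sat I H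
  end.

Definition model (A : Type) (I : set A) (Gamma : set (formula A)) : Prop :=
  forall F, Gamma F -> sat I F.

Fixpoint reduct (A : Type) (I : set A) (F : formula A) : formula A :=
  if `[< sat I F >] then
    match F with
    | FBot => FBot
    | FAtom a => FAtom a
    | FAnd G H => FAnd (reduct I G) (reduct I H)
    | FOr G H => FOr (reduct I G) (reduct I H)
    | FImp G H => FImp (reduct I G) (reduct I H)
    end
  else FBot.

Definition stable (A : Type) (Gamma : set (formula A)) (I : set A) : Prop :=
  let Gamma_I := [set reduct I F | F in Gamma] in
  model I Gamma_I /\ forall J, J `<=` I -> model J Gamma_I -> J = I.

Definition eval_cmp (L : language) (c : cmp) (r1 r2 : pterm L) : bool :=
  match c with
  | CEq => r1 == r2
  | CNeq => r1 != r2
  | CLt => plt r1 r2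
  | CGt => plt r2 r1
  | CLe => ple r1 r2
  | CGe => ple r2 r1
  end.

Definition signed (A : Type) (s : sign) (F : formula A) : formula A :=
  match s with
  | Pos => F
  | Not => FNot F
  | NotNot => FNot (FNot F)
  end.

(* The precomputed atoms p(r) for r in vals(t), where a is p(t). *)
Definition atom_vals (L : language) (a : atom L void) : seq (patom L) :=
  [seq (pred_symb a, r) | r <- vals_tuple (args a)].

Definition tau_body_elt (L : language) (b : body_elt L void) :
    formula (patom L) :=
  match b with
  | Literal s a => bigFOr [seq signed s (FAtom x) | x <- atom_vals a]
  | Comparison c t1 t2 =>
      if has (fun r1 => has (eval_cmp c r1) (vals t2)) (vals t1) then FTop
      else FBot
  end.

Definition tau_body (L : language) (B : seq (body_elt L void)) :
    formula (patom L) :=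
  bigFAnd (map (@tau_body_elt L) B).

Definition tau_rule (L : language) (R : rule L void) : formula (patom L) :=
  let B := tau_body (rule_body R) in
  match rule_head R with
  | HBasic a => FImp B (bigFAnd [seq FAtom x | x <- atom_vals a])
  | HChoice a =>
      FImp B (bigFAnd [seq FOr (FAtom x) (FNot (FAtom x)) | x <- atom_vals a])
  | HConstraint => FNot B
  end.

Definition tau (L : language) (Pi : program L) : set (formula (patom L)) :=
  [set tau_rule R | R in instances Pi].

Definition stable_model (L : language) (Pi : program L) (I : set (patom L)) :
    Prop :=
  stable (tau Pi) I.

Record strict_wf_order_on (A : Type) (I : set A) (lt : A -> A -> Prop) :
    Prop := {
  swo_on : forall a b, lt a b -> I a /\ I b;
  swo_irrefl : forall a, ~ lt a a;
  swo_trans : forall a b c, lt a b -> lt b c -> lt a c;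
  swo_wf : ~ exists u : nat -> A, forall i, lt (u i.+1) (u i)
}.

Definition well_supported (L : language) (Pi : program L)
    (I : set (patom L)) : Prop :=
  exists2 lt : patom L -> patom L -> Prop, strict_wf_order_on I lt &
    forall (p : symb L) (r : seq (pterm L)), I (p, r) ->
      exists2 R, instances Pi R &
        [/\ exists2 t, head_lit R = Some (Atom p t) & r \in vals_tuple t,
            sat I (tau_body (rule_body R))
          & forall (q : symb L) (t' : seq (term L void)),
              body_pos R (Atom q t') ->
              exists r', [/\ r' \in vals_tuple t', I (q, r')
                           & lt (q, r') (p, r)]].

Definition well_supported_model (L : language) (Pi : program L)
    (I : set (patom L)) : Prop :=
  well_supported Pi I /\ model I (tau Pi).

(* Main.v *)
Require Import Defs.
From mathcomp Require Import all_boot all_order all_algebra.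
From mathcomp Require Import boolp classical_sets cardinality.
From Stdlib Require List.

(** The reduct is used only through the logic of here-and-there: [J] satisfies
    the reduct [F^I] iff the pair with "here" world [J] and "there" world [I]
    satisfies [F]. In these terms, a subset [J] of a model [I] of the program
    satisfies the reduct iff it is closed under one step of supported
    derivation inside [I], so [I] is stable iff no proper subset of [I] is
    closed under this operator, and [I] is well-supported iff every atom of [I]
    is derived in one step from the atoms below it.

    What remains holds for any monotone operator on sets. If every element
    of [I] is derived from the elements below it, then a closed subset contains
    all of [I] by well-founded induction. Conversely, the operator commutes with
    unions of chains because rule bodies are finite, so the union of its finite
    iterates from the empty set is closed; if this union is [I], then [I] can be
    ordered by the iterate at which an element first appears. *)

Set Implicit Arguments.
Unset Strict Implicit.
Unset Printing Implicit Defensive.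

Local Open Scope classical_set_scope.

Lemma InP (T : eqType) (x : T) (s : seq T) : reflect (List.In x s) (x \in s).
Proof.
apply: (iffP idP); elim: s => //= y s IHs.
  by rewrite inE => /predU1P[->|/IHs]; [left|right].
by rewrite inE => -[->|/IHs ->]; rewrite ?eqxx ?orbT.
Qed.

Lemma nondecreasing_forall_In (T : Type) (P : nat -> set T) (s : seq T) :
    {homo P : m n / (m <= n)%N >-> m `<=` n} ->
    (forall x, List.In x s -> exists n, P n x) ->
  exists n, forall x, List.In x s -> P n x.
Proof.
move=> Pmono; elim: s => [|x s IHs] exP; first by exists 0%N.
have [m Px] := exP x (or_introl erefl).
have [n Ps] : exists n, forall y, List.In y s -> P n y.
  by apply: IHs => y ys; apply: exP; right.
exists (maxn m n) => y [<-|/Ps].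
  by apply: Pmono Px; exact: leq_maxl.
by apply: Pmono; exact: leq_maxr.
Qed.

Lemma strict_wf_order_ind (A : Type) (I : set A) (lt : A -> A -> Prop)
    (P : A -> Prop) :
    strict_wf_order_on I lt ->
    (forall x, I x -> (forall y, lt y x -> P y) -> P x) ->
  forall x, I x -> P x.
Proof.
move=> lt_swo Pstep x Ix; apply: contrapT => nPx; apply: (swo_wf lt_swo).
have smaller (z : {x | I x /\ ~ P x}) :
    {z' : {x | I x /\ ~ P x} | lt (sval z') (sval z)}.
  apply: cid; case: z => z /= [Iz nPz]; apply: contrapT => nsmaller.
  apply/nPz/Pstep => // y ltyz; apply: contrapT => nPy; apply: nsmaller.
  have [Iy _] := swo_on lt_swo ltyz.
  by exists (exist _ y (conj Iy nPy)).
have [u [_ ltu]] := dependent_choice smaller (exist _ x (conj Ix nPx)).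
by exists (sval \o u).
Qed.

Section FirstAppearance.
Context (A : Type) (F : nat -> set A).
Hypothesis Fmono : {homo F : m n / (m <= n)%N >-> m `<=` n}.

Definition appears_before (x y : A) : Prop :=
  (\bigcup_n F n) y /\ exists2 n, F n x & ~ F n y.

Lemma nondecreasing_mem_ltn (m n : nat) (x : A) :
  F m x -> ~ F n x -> (n < m)%N.
Proof.
move=> Fmx nFnx; rewrite ltnNge; apply/negP => lemn.
exact/nFnx/(Fmono lemn).
Qed.

Lemma appears_before_swo :
  strict_wf_order_on (\bigcup_n F n) appears_before.
Proof.
split.
- by move=> x y [Fy [n Fnx _]]; split=> //; exists n.
- by move=> x [_ [n]].
- move=> x y z [_ [m Fmx nFmy]] [Fz [n Fny nFnz]]; split=> //; exists n => //.
  exact: Fmono (ltnW (nondecreasing_mem_ltn Fny nFmy)) _ Fmx.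
- move=> [u decr].
  have nF n i : ~ F n (u i).
    elim: n i => [i F0|n IHn i Fn1].
      have [_ [m _]] := decr i; apply; exact: (Fmono (leq0n m)).
    have [_ [m Fm nFm]] := decr i.
    apply: (IHn i.+1); apply: Fmono Fm.
    exact: nondecreasing_mem_ltn Fn1 nFm.
  by have [[n _ /nF]] := decr 0%N.
Qed.

End FirstAppearance.

Section MinimalPrefixedPoint.
Context (A : Type) (D : set A -> set A).
Hypothesis Dmono : {homo D : J K / J `<=` K}.

Definition minimal_prefixed (I : set A) : Prop :=
  D I `<=` I /\ forall J, J `<=` I -> D J `<=` J -> J = I.

Definition wf_derivable (I : set A) : Prop :=
  exists2 lt, strict_wf_order_on I lt & forall x, I x -> D [set y | lt y x] x.

Lemma wf_derivable_sub_prefixed (I J : set A) :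
  wf_derivable I -> D J `<=` J -> I `<=` J.
Proof.
move=> [lt lt_swo Dlt] DJ; apply: (strict_wf_order_ind lt_swo) => x Ix ltJ.
by apply/DJ/(Dmono ltJ)/Dlt.
Qed.

Definition omega_continuous : Prop :=
  forall F : nat -> set A, {homo F : m n / (m <= n)%N >-> m `<=` n} ->
    D (\bigcup_n F n) `<=` \bigcup_n D (F n).

Lemma iter_set0_nondecreasing :
  {homo (fun n => iter n D set0) : m n / (m <= n)%N >-> m `<=` n}.
Proof.
apply: homo_leq => [J|J K L|n]; [exact: subset_refl|exact: subset_trans|].
by elim: n => [|n IHn]; [exact: sub0set|exact: Dmono].
Qed.

Lemma iter_set0_sub_prefixed (I : set A) (n : nat) :
  D I `<=` I -> iter n D set0 `<=` I.
Proof.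
move=> DI; elim: n => [|n IHn]; first exact: sub0set.
exact: subset_trans (Dmono IHn) DI.
Qed.

Hypothesis Dcont : omega_continuous.

Lemma bigcup_iter_prefixed :
  D (\bigcup_n iter n D set0) `<=` \bigcup_n iter n D set0.
Proof.
by move=> x /(Dcont iter_set0_nondecreasing)[n _ Dnx]; exists n.+1.
Qed.

Lemma minimal_prefixed_wf_derivable (I : set A) :
  minimal_prefixed I -> wf_derivable I.
Proof.
move=> [DI minI]; pose stage n := iter n D set0.
have <- : \bigcup_n stage n = I.
  apply: minI; last exact: bigcup_iter_prefixed.
  by apply: bigcup_sub => n _; exact: iter_set0_sub_prefixed.
exists (appears_before stage).
  exact: appears_before_swo iter_set0_nondecreasing.
move=> x Ux; have appears : exists n, `[< stage n x >].
  by have [n _ /asboolP Sx] := Ux; exists n.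
case: (ex_minnP appears) => -[/asboolP//|m] /asboolP Dx first.
apply: Dmono Dx => y Sy; split=> //; exists m => //.
by move=> /asboolP/first; rewrite ltnn.
Qed.

Lemma minimal_prefixedP (I : set A) :
  D I `<=` I -> minimal_prefixed I <-> wf_derivable I.
Proof.
move=> DI; split=> [|wfI]; first exact: minimal_prefixed_wf_derivable.
split=> // J JI DJ; apply/seteqP; split=> //.
exact: wf_derivable_sub_prefixed.
Qed.

End MinimalPrefixedPoint.

(* Satisfaction in the logic of here-and-there, with here world [J `&` I] and
   there world [I]. *)
Fixpoint ht_sat (A : Type) (J I : set A) (F : formula A) : Prop :=
  match F with
  | FBot => False
  | FAtom a => J a /\ I a
  | FAnd G H => ht_sat J I G /\ ht_sat J I H
  | FOr G H => ht_sat J I G \/ ht_sat J I H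
  | FImp G H => (sat I G -> sat I H) /\ (ht_sat J I G -> ht_sat J I H)
  end.

Section HereAndThere.
Context (A : Type).
Implicit Types (J I : set A) (F : formula A).

Lemma ht_sat_sat J I F : ht_sat J I F -> sat I F.
Proof.
elim: F => [//|a []//|G IHG H IHH [/IHG + /IHH]//|G IHG H IHH|G _ H _ []//].
by move=> [/IHG|/IHH]; [left|right].
Qed.

Lemma ht_sat_diag I F : ht_sat I I F <-> sat I F.
Proof. by elim: F => //= [a|G IHG H IHH|G IHG H IHH|G IHG H IHH]; tauto. Qed.

Lemma sat_reduct J I F : sat J (reduct I F) <-> ht_sat J I F.
Proof.
elim: F => [|a|G IHG H IHH|G IHG H IHH|G IHG H IHH] /=; case: asboolP => /=;
  rewrite ?IHG ?IHH; first [tauto | move: (@ht_sat_sat J I G)].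
all: by move: (@ht_sat_sat J I H); tauto.
Qed.

Lemma model_reduct_diag I (Gamma : set (formula A)) :
  model I [set reduct I F | F in Gamma] <-> model I Gamma.
Proof.
split=> [IG F GF|IG _ [F GF <-]]; last exact/sat_reduct/ht_sat_diag/IG.
by apply/ht_sat_diag/sat_reduct/IG; exists F.
Qed.

Lemma ht_sat_not J I F : ht_sat J I (FNot F) <-> ~ sat I F.
Proof. by split=> [[]//|nF]; split=> // /ht_sat_sat. Qed.

Lemma ht_sat_signed J I s F :
  s <> Pos -> ht_sat J I (signed s F) <-> sat I (signed s F).
Proof. by case: s => // _; rewrite ht_sat_not. Qed.

Lemma ht_sat_bigFAnd_map (T : Type) J I (f : T -> formula A) (s : seq T) :
  ht_sat J I (bigFAnd (map f s)) <->
  forall x, List.In x s -> ht_sat J I (f x).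
Proof.
elim: s => [|x [|y s] IHs]; first by split=> // _; split.
  by split=> [fx z [<-|[]]//|]; apply; left.
split=> [[fx /IHs fs] z [<-|/fs]//|fs]; split; first by apply: fs; left.
by apply/IHs => z sz; apply: fs; right.
Qed.

Lemma ht_sat_bigFOr_map (T : Type) J I (f : T -> formula A) (s : seq T) :
  ht_sat J I (bigFOr (map f s)) <->
  exists2 x, List.In x s & ht_sat J I (f x).
Proof.
elim: s => [|x [|y s] IHs]; first by split=> // -[].
  by split=> [fx|[z [<-|[]]]//]; exists x => //; left.
split=> [[fx|/IHs[z sz fz]]|[z [<-|sz] fz]].
- by exists x => //; left.
- by exists z => //; right.
- by left.
- by right; apply/IHs; exists z.
Qed.

End HereAndThere.

Section GroundRules.
Context (L : language).
Implicit Types (I J : set (patom L)) (R : rule L void) (x : patom L).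

Lemma In_atom_vals (p q : symb L) (t : seq (term L void))
    (r : seq (pterm L)) :
  List.In (p, r) (atom_vals (Atom q t)) <-> p = q /\ r \in vals_tuple t.
Proof.
split=> [/InP/mapP[r' tr' [-> ->]]//|[-> tr]].
by apply/InP/mapP; exists r.
Qed.

Definition head_vals R : set (patom L) :=
  [set x | exists2 a, head_lit R = Some a & List.In x (atom_vals a)].

Definition sat_body_pos J R : Prop :=
  forall a, body_pos R a -> exists2 x, List.In x (atom_vals a) & J x.

Lemma ht_sat_tau_body_elt J I (b : body_elt L void) :
  ht_sat J I (tau_body_elt b) <->
  sat I (tau_body_elt b) /\
  forall a, b = Literal Pos a ->
    exists2 x, List.In x (atom_vals a) & (J `&` I) x.
Proof.
split=> [Jb|[]].
  split=> [|a ba]; first exact: ht_sat_sat Jb.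
  by move: Jb; rewrite ba => /ht_sat_bigFOr_map.
case: b => [s a|c t1 t2] /=; last by case: ifP => // _ _ _; split.
have [-> _ /(_ a erefl) Ja|sNPos + _] := pselect (s = Pos).
  exact/ht_sat_bigFOr_map.
move=> /ht_sat_diag/ht_sat_bigFOr_map[x ax Ix]; apply/ht_sat_bigFOr_map.
by exists x => //; apply/ht_sat_signed/ht_sat_diag.
Qed.

Lemma ht_sat_tau_body J I R :
  ht_sat J I (tau_body (rule_body R)) <->
  sat I (tau_body (rule_body R)) /\ sat_body_pos (J `&` I) R.
Proof.
rewrite -ht_sat_diag !ht_sat_bigFAnd_map; split=> [JB|[IB posB] b Bb].
  split=> [b /JB|a /JB /ht_sat_tau_body_elt[_ /(_ a erefl)]//].
  by move=> /ht_sat_sat; rewrite -ht_sat_diag.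
apply/ht_sat_tau_body_elt; split=> [|a ba]; first exact/ht_sat_diag/IB.
by apply: posB; rewrite /body_pos /= -ba.
Qed.

Lemma ht_sat_tau_rule J I R :
  ht_sat J I (tau_rule R) <->
  sat I (tau_rule R) /\
  (ht_sat J I (tau_body (rule_body R)) -> head_vals R `&` I `<=` J).
Proof.
rewrite /tau_rule /head_vals /head_lit; case: (rule_head R) => [a|a|] /=.
- split=> -[IR JR]; split=> // JB.
    move=> x [[_ [<-] ax] _].
    by have /ht_sat_bigFAnd_map/(_ x ax)[] := JR JB.
  have /ht_sat_diag/ht_sat_bigFAnd_map IH := IR (ht_sat_sat JB).
  apply/ht_sat_bigFAnd_map => x ax; have [Ix _] := IH x ax.
  by split=> //; apply: JR => //; split=> //; exists a.
- split=> -[IR JR]; split=> // JB.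
    move=> x [[_ [<-] ax] Ix].
    by have /ht_sat_bigFAnd_map/(_ x ax)[[]|/ht_sat_not/(_ Ix)] := JR JB.
  apply/ht_sat_bigFAnd_map => x ax.
  have [Ix|nIx] := pselect (I x); last by right; apply/ht_sat_not.
  by left; split=> //; apply: JR => //; split=> //; exists a.
- by split=> -[IR JR]; split=> // JB; have := IR (ht_sat_sat JB).
Qed.

Context (Pi : program L).

Definition consequence I J : set (patom L) :=
  [set x | I x /\ exists2 R, instances Pi R &
    [/\ head_vals R x, sat I (tau_body (rule_body R)) & sat_body_pos J R]].

Lemma consequence_mono I : {homo consequence I : J K / J `<=` K}.
Proof.
move=> J K JK x [Ix [R PiR [headR bodyR posR]]]; split=> //.
by exists R => //; split=> // a /posR[y ay /JK Ky]; exists y.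
Qed.

Lemma consequence_sub I J : consequence I J `<=` I.
Proof. by move=> x []. Qed.

Lemma consequence_omega_continuous I : omega_continuous (consequence I).
Proof.
move=> F Fmono x [Ix [R PiR [headR bodyR posR]]].
pose P n b := forall a, b = Literal Pos a ->
  exists2 y, List.In y (atom_vals a) & F n y.
have [||n Pn] := @nondecreasing_forall_In _ P (rule_body R).
- by move=> m n /Fmono Fmn b Pb a /Pb[y ay /Fmn Fny]; exists y.
- move=> b Bb; have [[a ba]|nlit] := pselect (exists a, b = Literal Pos a).
    have [|y ay [n _ Fny]] := posR a; first by rewrite /body_pos /= -ba.
    by exists n => c; rewrite ba => -[<-]; exists y.
  by exists 0%N => a ba; case: nlit; exists a.
- exists n => //; split=> //; exists R => //.
  by split=> // a Ra; exact: Pn Ra _ erefl.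
Qed.

Lemma model_reduct_tau I J : J `<=` I -> model I (tau Pi) ->
  model J [set reduct I F | F in tau Pi] <-> consequence I J `<=` J.
Proof.
move=> JI IPi; split=> [JPi x [Ix [R PiR [headR bodyR posR]]]|Jclosed].
  have /sat_reduct/ht_sat_tau_rule[_] : sat J (reduct I (tau_rule R)).
    by apply: JPi; exists (tau_rule R) => //; exists R.
  by apply=> //; apply/ht_sat_tau_body; rewrite setIidl.
move=> _ [_ [R PiR <-] <-]; apply/sat_reduct/ht_sat_tau_rule.
split=> [|]; first by apply: IPi; exists R.
move=> /ht_sat_tau_body; rewrite setIidl // => -[bodyR posR] x [headR Ix].
by apply: Jclosed; split=> //; exists R.
Qed.

Lemma stable_modelP I :
  stable_model Pi I <->
  model I (tau Pi) /\ minimal_prefixed (consequence I) I.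
Proof.
split=> [[/model_reduct_diag IPi minI]|[IPi [_ minI]]].
  split=> //; split=> [|J JI /(model_reduct_tau JI IPi)].
    exact: consequence_sub.
  exact: minI.
split=> [|J JI /(model_reduct_tau JI IPi)]; first exact/model_reduct_diag.
exact: minI.
Qed.

Lemma well_supportedP I :
  well_supported Pi I <-> wf_derivable (consequence I) I.
Proof.
split=> -[lt lt_swo supp]; exists lt => //.
  move=> [p r] Ipr; have [R PiR [[t headR tr] bodyR posR]] := supp p r Ipr.
  split=> //; exists R => //; split=> //.
    by exists (Atom p t) => //; apply/In_atom_vals.
  move=> [q t'] /posR[r' [t'r' _ lt_r']]; exists (q, r') => //.
  exact/In_atom_vals.
move=> p r /supp[Ipr [R PiR [[[p' t] headR /In_atom_vals[pp' tr]] bodyR posR]]].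
exists R => //; split=> //; first by exists t; rewrite ?pp'.
move=> q t' /posR[[q' r'] /In_atom_vals[-> t'r'] lt_r'].
by exists r'; split=> //; have [] := swo_on lt_swo lt_r'.
Qed.

End GroundRules.

Theorem mainTheorem1 (L : language) (Pi : program L) (I : set (patom L)) :
  stable_model Pi I <-> well_supported_model Pi I.
Proof.
rewrite stable_modelP /well_supported_model well_supportedP andC.
rewrite (minimal_prefixedP (@consequence_mono L Pi I)) //.
- exact: consequence_omega_continuous.
- exact: consequence_sub.
Qed.
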